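(* Let $(\Omega,\mu)$ be a measure space, let $p\in[3,\infty)$, $p'=\frac{p}{p-1}$, and let $m\in\mathbb{N}$. Assume that $(u_k)$ is a sequence with $u_k\rightharpoonup u$ in $L^p(\Omega,\mu;\mathbb{R}^m)$ and $|u_k-u|^{p-2}(u_k-u)\rightharpoonup 0$ in $L^{p'}(\Omega,\mu;\mathbb{R}^m)$. Then, as $k\to\infty$, $$\int_\Omega |u_k|^p\,d\mu\ \ge\ \int_\Omega |u|^p\,d\mu+\int_\Omega |u_k-u|^p\,d\mu+o(1).$$
   Context: $\rightharpoonup$ denotes weak convergence as $k\to\infty$; $|\cdot|$ is the Euclidean norm on $\mathbb{R}^m$. The conclusion ''$a_k\ge b_k+o(1)$'' means that there is a real sequence $\varepsilon_k\to 0$ with $a_k\ge b_k+\varepsilon_k$ for all $k$. No almost everywhere convergence is assumed. *)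

(* Defs.v *)
From HB Require Import structures.
From mathcomp Require Import all_boot all_order all_algebra.
From mathcomp Require Import all_classical all_reals all_analysis.

Set Implicit Arguments.
Unset Strict Implicit.
Unset Printing Implicit Defensive.
Import Order.TTheory GRing.Theory Num.Theory.
Import numFieldNormedType.Exports.

Local Open Scope classical_set_scope.
Local Open Scope ring_scope.

(* The library norm on 'rV[R]_m is the sup norm, hence this definition. *)
Definition enorm (R : realType) (m : nat) (v : 'rV[R]_m) : R :=
  Num.sqrt (\sum_(i < m) v ord0 i ^+ 2).

Definition vLnorm d (T : measurableType d) (R : realType)
    (mu : {measure set T -> \bar R}) (p : R) (m : nat)
    (f : T -> 'rV[R]_m) : \bar R :=
  Lnorm mu p%:E (fun x => (enorm (f x))%:E).

(* Borel measurability into R^m is expressed coordinatewise.  Members are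
   functions rather than classes modulo mu-a.e. equality. *)
Definition vLp d (T : measurableType d) (R : realType)
    (mu : {measure set T -> \bar R}) (p : R) (m : nat) :
    set (T -> 'rV[R]_m) :=
  [set f : T -> 'rV[R]_m |
     (forall i, measurable_fun [set: T] (fun x => f x ord0 i)) /\
     (vLnorm mu p f < +oo)%E].

(* Only the values of l on vLp matter.  Linearity and boundedness force l to
   agree on a.e. equal members of vLp, so these are exactly the continuous
   linear functionals on the quotient space L^p(T, mu; R^m). *)
Definition vLp_dual d (T : measurableType d) (R : realType)
    (mu : {measure set T -> \bar R}) (p : R) (m : nat) :
    set ((T -> 'rV[R]_m) -> R) :=
  [set l : (T -> 'rV[R]_m) -> R |
     (forall (a : R) (f g : T -> 'rV[R]_m),
        vLp mu p f -> vLp mu p g ->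
        l (fun x => a *: f x + g x) = a * l f + l g) /\
     (exists C : R, forall f : T -> 'rV[R]_m, vLp mu p f ->
        (`|l f|%:E <= C%:E * vLnorm mu p f)%E)].

Definition weak_cvg_vLp d (T : measurableType d) (R : realType)
    (mu : {measure set T -> \bar R}) (p : R) (m : nat)
    (u_ : nat -> T -> 'rV[R]_m) (u : T -> 'rV[R]_m) : Prop :=
  [/\ forall k, vLp mu p (u_ k), vLp mu p u &
      forall l, vLp_dual mu p l -> l (u_ k) @[k --> \oo] --> l u].

(* Main.v *)
Require Import Defs.
From HB Require Import structures.
From mathcomp Require Import all_boot all_order all_algebra.
From mathcomp Require Import all_classical all_reals all_analysis.
From mathcomp Require Import measurable_realfun ring lra.

Set Implicit Arguments.
Unset Strict Implicit.
Unset Printing Implicit Defensive.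
Import Order.TTheory GRing.Theory Num.Theory.
Import numFieldNormedType.Exports.

Local Open Scope classical_set_scope.
Local Open Scope ring_scope.

(** Put [b = u_k - u].  The theorem is an integrated pointwise inequality: for
    [p >= 3] and vectors [a], [b],
      [|a + b|^p >= |a|^p + |b|^p + p (|a|^(p-2) + |b|^(p-2)) <a, b>]
    ([enorm_powRD_ge]).  With [a = u(x)], the two cross terms integrate to
      [p \int <|u|^(p-2) u, u_k - u>]  and  [p \int <u, |b|^(p-2) b>].
    By Hoelder, pairing with a fixed element of [L^q] is a continuous linear
    functional on [L^p] when [1/p + 1/q = 1] ([vdot_pairing_dual]).  Here
    [|u|^(p-2) u] lies in [L^p'] and [u] in [L^p], so the two weak convergence
    hypotheses send the two cross terms to [0], and their sum is the error.

    For the pointwise inequality, put [x = |a|^2], [y = |b|^2], [w = |a + b|^2]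
    and [q = (p-2)/2 >= 1/2], so that [2 <a, b> = w - x - y].  The claim becomes
    an inequality between the nonnegative reals [w], [x], [y]
    ([powR_square_expansion]), in which [w] may be treated as a free variable.
    Minimizing over [w], which is Young's inequality ([young_tangent]), leaves
    an inequality between [X = x^q] and [Y = y^q]: with [n = 1 + 1/q],
      [(X + Y)^n <= X^n + Y^n + n (X^(n-1) Y + X Y^(n-1))].
    It holds because [1 <= n <= 3] ([powRD_le_cross]), and [n <= 3] is exactly
    the hypothesis [p >= 3]; for [n = 3] it is the binomial identity. *)

(** * Inequalities between real powers *)

Lemma weighted_amgm (R : realType) (a x y : R) :
  0 <= a <= 1 -> 0 <= x -> 0 <= y ->
  x `^ a * y `^ (1 - a) <= a * x + (1 - a) * y.
Proof.
move=> /andP[]; rewrite le_eqVlt => /predU1P[<- _ x0 y0|a0].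
  by rewrite powRr0 subr0 powRr1//; lra.
rewrite le_eqVlt => /predU1P[->|a1] x0 y0.
  by rewrite subrr powRr0 powRr1//; lra.
have b0 : 0 < 1 - a by rewrite subr_gt0.
have := @conjugate_powR R (x `^ a) (y `^ (1 - a)) a^-1 (1 - a)^-1.
rewrite !invr_gt0 !invrK !powR_ge0 -!powRrM !mulfV ?gt_eqF// !powRr1//.
move=> /(_ isT isT a0 b0); rewrite addrC subrK => /(_ erefl).
by rewrite ![_ * x]mulrC ![_ * y]mulrC.
Qed.

Lemma mul_powRS (R : realType) (a x : R) :
  0 <= a -> 0 <= x -> x `^ (a + 1) = x * x `^ a.
Proof.
by move=> a0 x0; rewrite powRD ?powRr1 1?mulrC// gt_eqF// ltr_wpDl.
Qed.

Lemma powR_split (R : realType) (a x : R) :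
  0 <= x -> x = x `^ a * x `^ (1 - a).
Proof.
by move=> x0; rewrite -powRD (addrC a) subrK ?powRr1// oner_eq0.
Qed.

(** The tangent line bound [(x + y)^a <= x^a + a x^(a-1) y] for the concave
    function [t^a], multiplied by [x] so that it makes sense at [x = 0].  It is
    the weighted AM-GM inequality for [x + y] and [x], multiplied by [x^a]. *)
Lemma powRD_tangent (R : realType) (a x y : R) :
  0 <= a <= 1 -> 0 <= x -> 0 <= y ->
  x * (x + y) `^ a <= x `^ (a + 1) + a * (x `^ a * y).
Proof.
move=> a01 x0 y0; have /andP[a0 a1] := a01.
rewrite mul_powRS// [X in X * _ <= _](powR_split a x0).
have := weighted_amgm a01 (addr_ge0 x0 y0) x0.
have := powR_ge0 x a; set X := x `^ a; set Z := _ `^ (1 - a); set S := _ `^ a.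
nra.
Qed.

(** Each [z] in [{x, y}] satisfies [z <= z^a s^(1-a)] with [s = x + y]; summing
    and dividing by [s^(1-a)] gives subadditivity. *)
Lemma powRD_subadd (R : realType) (a x y : R) :
  0 <= a <= 1 -> 0 <= x -> 0 <= y ->
  (x + y) `^ a <= x `^ a + y `^ a.
Proof.
move=> /andP[a0 a1] x0 y0.
have [s0|s0] := eqVneq (x + y) 0.
  have -> : x = 0 by lra.
  have -> : y = 0 by lra.
  by rewrite addr0 lerDl powR_ge0.
have sp : 0 < x + y by rewrite lt_def s0 addr_ge0.
have zle (z : R) : 0 <= z -> z <= x + y -> z <= z `^ a * (x + y) `^ (1 - a).
  move=> z0 zs; rewrite {1}(powR_split a z0) ler_wpM2l ?powR_ge0//.
  by apply: ge0_ler_powR; rewrite ?nnegrE//; lra.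
rewrite -(@ler_pM2r _ ((x + y) `^ (1 - a))) ?powR_gt0// -powR_split; last lra.
by rewrite mulrDl lerD// zle//; lra.
Qed.

(** Write [n = a + j] with [0 <= a <= 1] and [j = 1] or [j = 2], expand
    [(x + y)^n = (x + y)^j (x + y)^a], and bound [(x + y)^a] by its tangent at
    [x] in the term with [x^j], by its tangent at [y] in the term with [y^j],
    and by [x^a + y^a] in the mixed term [2 x y].  The cross coefficient is then
    [a + 2 = n] for [j = 2], and [a <= n] for [j = 1]. *)
Lemma powRD_le_cross (R : realType) (n x y : R) :
  1 <= n <= 3 -> 0 <= x -> 0 <= y ->
  (x + y) `^ n <=
    x `^ n + y `^ n + n * (x `^ (n - 1) * y + x * y `^ (n - 1)).
Proof.
move=> /andP[n1 n3] x0 y0.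
have s0 : 0 <= x + y by rewrite addr_ge0.
have [n2|n2] := leP n 2.
  pose a := n - 1.
  have a01 : 0 <= a <= 1 by rewrite /a; lra.
  have a0 : 0 <= a by rewrite /a; lra.
  have -> : n = a + 1 by rewrite /a; lra.
  rewrite addrK (mul_powRS a0 s0).
  have h1 := powRD_tangent a01 x0 y0.
  have h2 := powRD_tangent a01 y0 x0; rewrite [y + x]addrC in h2.
  have h3 := mulr_ge0 (powR_ge0 x a) y0.
  have h4 := mulr_ge0 (powR_ge0 y a) x0.
  lra.
pose a := n - 2.
have a01 : 0 <= a <= 1 by rewrite /a; lra.
have a0 : 0 <= a by rewrite /a; lra.
have a1 : 0 <= a + 1 by rewrite /a; lra.
have nE : n = (a + 1) + 1 by rewrite /a; lra.
rewrite nE addrK !(mul_powRS a1)// !(mul_powRS a0)//.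
have h1 := ler_wpM2l x0 (powRD_tangent a01 x0 y0).
have h2 := ler_wpM2l y0 (powRD_tangent a01 y0 x0).
rewrite [y + x]addrC in h2.
have h3 := ler_wpM2l (mulr_ge0 x0 y0) (powRD_subadd a01 x0 y0).
rewrite !(mul_powRS a0)// in h1 h2 *.
lra.
Qed.

(** The graph of [w^(q+1)] lies above its tangent at [z]: this is Young's
    inequality for [w] and [z^q] with the exponents [q + 1] and [(q + 1) / q]. *)
Lemma young_tangent (R : realType) (q w z : R) :
  0 < q -> 0 <= w -> 0 <= z ->
  (q + 1) * (w * z `^ q) <= w `^ (q + 1) + q * z `^ (q + 1).
Proof.
move=> q0 w0 z0; have q1 : 0 < q + 1 by lra.
have qn0 : q != 0 by rewrite gt_eqF.
have q1n0 : q + 1 != 0 by rewrite gt_eqF.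
have h := @conjugate_powR R w (z `^ q) (q + 1) ((q + 1) / q)
  w0 (powR_ge0 _ _) q1.
have e : (q + 1)^-1 + ((q + 1) / q)^-1 = 1 by field; rewrite qn0 q1n0.
have {h} := h (divr_gt0 q1 q0) e.
rewrite -powRrM mulrCA mulfV// mulr1 => h.
have := ler_wpM2l (ltW q1) h.
set A := w `^ _; set B := z `^ (q + 1).
suff -> : (q + 1) * (A / (q + 1) + B / ((q + 1) / q)) = A + q * B by [].
by field; rewrite qn0 q1n0.
Qed.

(** The right-hand side minus the left-hand side is convex in [w]; it is
    minimal at the [z] with [z^q = x^q + y^q], and its value there is
    nonnegative by [powRD_le_cross] with exponent [1 + 1/q], which is at most
    [3] because [q >= 1/2]. *)
Lemma powR_square_expansion (R : realType) (q w x y : R) : 2^-1 <= q ->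
  0 <= w -> 0 <= x -> 0 <= y ->
  x `^ (q + 1) + y `^ (q + 1) + (q + 1) * ((w - x - y) * (x `^ q + y `^ q))
  <= w `^ (q + 1).
Proof.
move=> hq w0 x0 y0.
have q0 : 0 < q by lra.
have qn0 : q != 0 by rewrite gt_eqF.
have M0 : 0 <= x `^ q + y `^ q by rewrite addr_ge0// powR_ge0.
(* The tangent is taken at the minimizer z = (x^q + y^q)^(1/q). *)
have := young_tangent q0 w0 (powR_ge0 (x `^ q + y `^ q) q^-1).
rewrite -!powRrM mulVf// powRr1//.
have n13 : 1 <= q^-1 * (q + 1) <= 3.
  rewrite mulrDr mulVf// mulr1 lerDl invr_ge0 (ltW q0)/=.
  suff : q^-1 <= 2 by lra.
  by rewrite -(invrK 2) lef_pV2 ?posrE ?invr_gt0.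
have := powRD_le_cross n13 (powR_ge0 x q) (powR_ge0 y q).
rewrite -!powRrM.
have -> : q * (q^-1 * (q + 1)) = q + 1 by rewrite mulVKf.
have -> : q * (q^-1 * (q + 1) - 1) = 1 by field.
rewrite !powRr1// !(mul_powRS (ltW q0))//.
set N := (_ + _) `^ _ => /(ler_wpM2l (ltW q0)).
rewrite [X in _ <= X -> _]mulrDr [q * (q^-1 * _ * _)]mulrA mulVKf//.
lra.
Qed.

(** * The Euclidean inner product and norm *)

Definition vdot (R : realType) (m : nat) (v w : 'rV[R]_m) : R :=
  \sum_(i < m) v ord0 i * w ord0 i.

Lemma vdotC (R : realType) (m : nat) (v w : 'rV[R]_m) : vdot v w = vdot w v.
Proof. by apply: eq_bigr => i _; rewrite mulrC. Qed.

(** [vdotPr] and [vdotPl] have the combined form [a *: w + z] in which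
    linearity of the members of [vLp_dual] is expressed. *)
Lemma vdotPr (R : realType) (m : nat) (a : R) (v w z : 'rV[R]_m) :
  vdot v (a *: w + z) = a * vdot v w + vdot v z.
Proof.
by rewrite mulr_sumr -big_split; apply: eq_bigr => i _; rewrite !mxE/=; ring.
Qed.

Lemma vdotPl (R : realType) (m : nat) (a : R) (v w z : 'rV[R]_m) :
  vdot (a *: w + z) v = a * vdot w v + vdot z v.
Proof. by rewrite vdotC vdotPr !(vdotC v). Qed.

Lemma vdotBr (R : realType) (m : nat) (v w z : 'rV[R]_m) :
  vdot v (w - z) = vdot v w - vdot v z.
Proof. by rewrite addrC -scaleN1r vdotPr mulN1r addrC. Qed.

Lemma vdot0r (R : realType) (m : nat) (v : 'rV[R]_m) : vdot v 0 = 0.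
Proof. by rewrite -(subrr v) vdotBr subrr. Qed.

Lemma vdotZl (R : realType) (m : nat) (a : R) (v w : 'rV[R]_m) :
  vdot (a *: v) w = a * vdot v w.
Proof. by rewrite -[a *: v]addr0 vdotPl (vdotC 0) vdot0r addr0. Qed.

Lemma vdot_ge0 (R : realType) (m : nat) (v : 'rV[R]_m) : 0 <= vdot v v.
Proof. by apply: sumr_ge0 => i _; rewrite -expr2 sqr_ge0. Qed.

Lemma enormE (R : realType) (m : nat) (v : 'rV[R]_m) :
  enorm v = vdot v v `^ 2^-1.
Proof.
by rewrite powR12_sqrt ?vdot_ge0//; congr Num.sqrt; apply: eq_bigr => i _.
Qed.

Lemma enorm_ge0 (R : realType) (m : nat) (v : 'rV[R]_m) : 0 <= enorm v.
Proof. exact: sqrtr_ge0. Qed.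

Lemma enorm_sqr (R : realType) (m : nat) (v : 'rV[R]_m) :
  enorm v ^+ 2 = vdot v v.
Proof.
rewrite -powR_mulrn ?enorm_ge0// enormE -powRrM mulVf ?pnatr_eq0//.
by rewrite powRr1// vdot_ge0.
Qed.

Lemma enorm_powR (R : realType) (m : nat) (v : 'rV[R]_m) (q : R) :
  enorm v `^ q = vdot v v `^ (q / 2).
Proof. by rewrite enormE -powRrM mulrC. Qed.

Lemma enormZ (R : realType) (m : nat) (a : R) (v : 'rV[R]_m) :
  0 <= a -> enorm (a *: v) = a * enorm v.
Proof.
move=> a0; apply: (@pexpIrn R 2) => //; rewrite ?nnegrE ?mulr_ge0 ?enorm_ge0//.
by rewrite exprMn !enorm_sqr vdotZl vdotC vdotZl mulrA expr2.
Qed.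

Lemma enorm0_eq0 (R : realType) (m : nat) (v : 'rV[R]_m) :
  enorm v = 0 -> v = 0.
Proof.
move=> v0; have : vdot v v = 0 by rewrite -enorm_sqr v0 expr0n.
move=> /psumr_eq0P vv; apply/rowP => i; rewrite mxE.
apply/eqP; rewrite -sqrf_eq0 expr2 vv// => j _.
by rewrite -expr2 sqr_ge0.
Qed.

(** Expand [0 <= | |w| v + |v| w |^2] and [0 <= | |w| v - |v| w |^2], and divide
    by [2 |v| |w|] unless one of the vectors vanishes. *)
Lemma cauchy_schwarz_vdot (R : realType) (m : nat) (v w : 'rV[R]_m) :
  `|vdot v w| <= enorm v * enorm w.
Proof.
(* The trailing zero vector brings the combinations into the form expected by
   vdotPl and vdotPr. *)
have hs := vdot_ge0 (enorm w *: v + (enorm v *: w + 0)).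
have hd := vdot_ge0 (enorm w *: v + (- enorm v *: w + 0)).
move: hs hd; rewrite !(vdotPl, vdotPr) !vdot0r !(vdotC 0) !vdot0r (vdotC w v).
rewrite -!enorm_sqr.
have := enorm_ge0 v; have := enorm_ge0 w.
have v0 : enorm v = 0 -> vdot v w = 0.
  by move=> /enorm0_eq0 ->; rewrite vdotC vdot0r.
have w0 : enorm w = 0 -> vdot v w = 0.
  by move=> /enorm0_eq0 ->; rewrite vdot0r.
move: v0 w0; set a := enorm v; set b := enorm w; set c := vdot v w.
move=> va0 wb0 b0 a0 hs hd.
have [/va0 ->|ap] := eqVneq a 0; first by rewrite normr0 mulr_ge0.
have [/wb0 ->|bp] := eqVneq b 0; first by rewrite normr0 mulr_ge0.
have ab0 : 0 < b * a by rewrite mulr_gt0 ?lt_def ?ap ?bp ?a0 ?b0.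
rewrite ler_norml; apply/andP; split; rewrite -(ler_pM2l ab0); nra.
Qed.

(** This is [powR_square_expansion] for the squared norms of [v], [w] and
    [v + w], with [q = (p - 2) / 2]. *)
Lemma enorm_powRD_ge (R : realType) (m : nat) (p : R) (v w : 'rV[R]_m) :
  3 <= p ->
  enorm v `^ p + enorm w `^ p
    + p * ((enorm v `^ (p - 2) + enorm w `^ (p - 2)) * vdot v w)
  <= enorm (v + w) `^ p.
Proof.
move=> p3; rewrite !enorm_powR.
have hq : 2^-1 <= (p - 2) / 2 by lra.
have := powR_square_expansion hq (vdot_ge0 (v + w)) (vdot_ge0 v) (vdot_ge0 w).
have -> : (p - 2) / 2 + 1 = p / 2 by lra.
have -> : vdot (v + w) (v + w) - vdot v v - vdot w w = 2 * vdot v w.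
  rewrite -[v in vdot (v + w)]scale1r -[v in vdot _ (v + w)]scale1r.
  by rewrite vdotPl !vdotPr (vdotC w v); ring.
by move=> h; apply: le_trans h; lra.
Qed.

(** * Duality between L^p and L^q for vector-valued functions *)

Section vector_Lp.
Context (d : measure_display) (T : measurableType d) (R : realType).
Context (mu : {measure set T -> \bar R}) (m : nat).
Implicit Types (p q : R) (f g : T -> 'rV[R]_m).

Definition coord_measurable f :=
  forall i, measurable_fun [set: T] (fun x => f x ord0 i).

Lemma measurable_vdot f g : coord_measurable f -> coord_measurable g ->
  measurable_fun [set: T] (fun x => vdot (f x) (g x)).
Proof.
by move=> mf mg; apply: measurable_sum => i; exact: measurable_funM.
Qed.

Lemma measurable_enorm_powR p f : coord_measurable f ->
  measurable_fun [set: T] (fun x => enorm (f x) `^ p).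
Proof.
move=> mf; under eq_fun do rewrite enorm_powR.
by apply: (measurableT_comp (measurable_powR _)) => //; exact: measurable_vdot.
Qed.

Lemma measurable_enorm f : coord_measurable f ->
  measurable_fun [set: T] (fun x => enorm (f x)).
Proof.
move=> /(measurable_enorm_powR 1).
by under eq_fun do rewrite powRr1 ?enorm_ge0//.
Qed.

Lemma vLpP p f : 0 < p ->
  vLp mu p f <->
  coord_measurable f /\ (\int[mu]_x (enorm (f x) `^ p)%:E < +oo)%E.
Proof.
move=> p0.
have E : (\int[mu]_x `|(enorm (f x))%:E| `^ p
    = \int[mu]_x (enorm (f x) `^ p)%:E)%E.
  by apply: eq_integral => x _; rewrite gee0_abs ?lee_fin ?enorm_ge0//.
rewrite /vLp /vLnorm /=; split => -[mf].
  rewrite unlock E => fy; split => //.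
  by apply: lty_poweRy fy; rewrite invr_neq0 ?gt_eqF.
by move=> fy; split => //; rewrite unlock E poweR_lty.
Qed.

Lemma vLp_integrable p f : 0 < p -> vLp mu p f ->
  mu.-integrable [set: T] (fun x => (enorm (f x) `^ p)%:E).
Proof.
move=> p0 /(proj1 (vLpP _ p0))[mf fy]; apply/integrableP; split.
  by apply/measurable_EFinP; exact: measurable_enorm_powR.
by under eq_integral do rewrite gee0_abs ?lee_fin ?powR_ge0//.
Qed.

Section pairing.
Context (p q : R) (p0 : 0 < p) (q0 : 0 < q) (pq : p^-1 + q^-1 = 1).

Lemma vdot_hoelder f g : vLp mu p f -> vLp mu q g ->
  (\int[mu]_x `|(vdot (g x) (f x))%:E| <= vLnorm mu q g * vLnorm mu p f)%E.
Proof.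
move=> [mf _] [mg _].
have := hoelder mu (measurable_enorm mg) (measurable_enorm mf) q0 p0.
rewrite addrC => /(_ pq); apply: le_trans.
rewrite Lnorm1; apply: ge0_le_integral => //.
- by do 2 apply: measurableT_comp => //; exact: measurable_vdot.
- do 2 apply: measurableT_comp => //.
  by apply: measurable_funM; exact: measurable_enorm.
- move=> x _; rewrite lee_fin [leRHS]ger0_norm ?mulr_ge0 ?enorm_ge0//.
  exact: cauchy_schwarz_vdot.
Qed.

Lemma integrable_vdot f g : vLp mu p f -> vLp mu q g ->
  mu.-integrable [set: T] (fun x => (vdot (g x) (f x))%:E).
Proof.
move=> Lf Lg; apply/integrableP; split.
  by apply/measurable_EFinP; apply: measurable_vdot; [case: Lg|case: Lf].
apply: le_lt_trans (vdot_hoelder Lf Lg) _.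
by apply: lte_mul_pinfty; rewrite ?Lnorm_ge0 ?ge0_fin_numE ?Lnorm_ge0//;
  [case: Lg|case: Lf].
Qed.

(** This turns weak convergence into convergence of integrals: boundedness is
    Hoelder's inequality, with constant the [L^q] norm of [g]. *)
Lemma vdot_pairing_dual g : vLp mu q g ->
  vLp_dual mu p (fun f => \int[mu]_x vdot (g x) (f x)).
Proof.
move=> Lg; split.
  move=> a f h Lf Lh.
  rewrite -RintegralZl//; last exact: integrable_vdot.
  rewrite -RintegralD//; last exact: integrable_vdot.
    by apply: eq_Rintegral => x _; rewrite vdotPr.
  by have := integrableZl measurableT a (integrable_vdot Lf Lg).
exists (fine (vLnorm mu q g)) => f Lf.
rewrite fineK ?ge0_fin_numE ?Lnorm_ge0//; last by case: Lg.
apply: le_trans (vdot_hoelder Lf Lg).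
rewrite EFin_normr_Rintegral//; last exact: integrable_vdot.
apply: le_abse_integral => //.
by apply/measurable_EFinP; apply: measurable_vdot; [case: Lg|case: Lf].
Qed.

End pairing.

Lemma enorm_duality_map p (v : 'rV[R]_m) : 2 <= p ->
  enorm (enorm v `^ (p - 2) *: v) `^ (p / (p - 1)) = enorm v `^ p.
Proof.
move=> p2; have p1 : p - 1 != 0 by rewrite subr_eq0 gt_eqF//; lra.
have p20 : 0 <= p - 2 by rewrite subr_ge0.
rewrite enormZ ?powR_ge0// mulrC -mul_powRS ?enorm_ge0//.
by rewrite -powRrM; congr (_ `^ _); field.
Qed.

(** The duality map takes [u] into the dual space; read backwards, membership of
    [|u_k - u|^(p-2) (u_k - u)] in [L^p'] gives [u_k - u] in [L^p] without
    Minkowski's inequality. *)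
Lemma vLp_duality_map p f : 2 <= p -> coord_measurable f ->
  vLp mu (p / (p - 1)) (fun x => enorm (f x) `^ (p - 2) *: f x) <-> vLp mu p f.
Proof.
move=> p2 mf.
have p0 : 0 < p by apply: lt_le_trans p2.
have p1 : 0 < p - 1 by rewrite subr_gt0; apply: lt_le_trans p2; rewrite ltr1n.
have q0 : 0 < p / (p - 1) by rewrite divr_gt0.
have mh : coord_measurable (fun x => enorm (f x) `^ (p - 2) *: f x).
  move=> i; under eq_fun do rewrite mxE.
  by apply: measurable_funM => //; exact: measurable_enorm_powR.
have E : (\int[mu]_x (enorm (enorm (f x) `^ (p - 2) *: f x) `^ (p / (p - 1)))%:E
    = \int[mu]_x (enorm (f x) `^ p)%:E)%E.
  by apply: eq_integral => x _; rewrite enorm_duality_map.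
split=> [/(proj1 (vLpP _ q0))|/(proj1 (vLpP _ p0))] -[_ fy].
  by apply: (proj2 (vLpP _ p0)); split; rewrite -?E.
by apply: (proj2 (vLpP _ q0)); split; rewrite ?E.
Qed.

End vector_Lp.

(** * The lower bound without almost everywhere convergence *)

Theorem theorem2p1 (d : measure_display) (T : measurableType d) (R : realType)
    (mu : {measure set T -> \bar R}) (p : R) (hp : 3 <= p) (m : nat)
    (u_ : nat -> T -> 'rV[R]_m) (u : T -> 'rV[R]_m)
    (hu : weak_cvg_vLp mu p u_ u)
    (hv : weak_cvg_vLp mu (p / (p - 1))
            (fun k x => (enorm (u_ k x - u x) `^ (p - 2)) *: (u_ k x - u x))
            (fun _ => 0)) :
  exists eps : nat -> R,
    eps k @[k --> \oo] --> (0 : R) /\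
    forall k : nat,
      (\int[mu]_x (enorm (u_ k x) `^ p)%:E >=
       \int[mu]_x (enorm (u x) `^ p)%:E +
       \int[mu]_x (enorm (u_ k x - u x) `^ p)%:E + (eps k)%:E)%E.
Proof.
case: hu => Lu_ Lu cu; case: hv => Lh Lz ch.
have p2 : 2 <= p by apply: le_trans hp; rewrite ler_nat.
have p0 : 0 < p by apply: lt_le_trans p2.
have p1 : 0 < p - 1 by rewrite subr_gt0; apply: lt_le_trans p2; rewrite ltr1n.
have q0 : 0 < p / (p - 1) by rewrite divr_gt0.
have pq : p^-1 + (p / (p - 1))^-1 = 1 by field; rewrite !gt_eqF.
have qp : (p / (p - 1))^-1 + p^-1 = 1 by rewrite addrC.
pose g x := enorm (u x) `^ (p - 2) *: u x.
have Lg : vLp mu (p / (p - 1)) g by apply/vLp_duality_map => //; case: Lu.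
pose v k x := u_ k x - u x.
have mv k : coord_measurable (v k).
  move=> i; under eq_fun do rewrite !mxE.
  by apply: measurable_funB; [case: (Lu_ k)|case: Lu].
have Lv k : vLp mu p (v k) := proj1 (vLp_duality_map mu p2 (mv k)) (Lh k).
pose h k x := enorm (v k x) `^ (p - 2) *: v k x.
pose L1 (f : T -> 'rV[R]_m) := \int[mu]_x vdot (g x) (f x).
pose L2 (f : T -> 'rV[R]_m) := \int[mu]_x vdot (u x) (f x).
have cL1 : L1 (u_ k) @[k --> \oo] --> L1 u.
  exact/cu/(vdot_pairing_dual p0 q0 pq Lg).
have cL2 : L2 (h k) @[k --> \oo] --> 0.
  have -> : 0 = L2 (fun=> 0).
    rewrite /L2; under eq_Rintegral do rewrite vdot0r.
    by rewrite /Rintegral integral0.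
  exact: (ch _ (vdot_pairing_dual q0 p0 qp Lu)).
exists (fun k => p * (L1 (u_ k) - L1 u + L2 (h k))); split.
  have -> : 0 = p * (L1 u - L1 u + 0) by rewrite subrr addr0 mulr0.
  apply: cvgM; first exact: cvg_cst.
  by apply: cvgD => //; apply: cvgB => //; exact: cvg_cst.
move=> k.
have i1 := integrable_vdot p0 q0 pq (Lu_ k) Lg.
have i2 := integrable_vdot p0 q0 pq Lu Lg.
have i3 := integrable_vdot q0 p0 qp (Lh k) Lu.
(* The error term as the integral of e, so that the conclusion is the integral
   of a pointwise inequality. *)
pose e x := p * (vdot (g x) (u_ k x) - vdot (g x) (u x) + vdot (u x) (h k x)).
have i12 := integrableB measurableT i1 i2.
have i123 := integrableD measurableT i12 i3.
have ie : mu.-integrable [set: T] (EFin \o e) := integrableZl measurableT p i123.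
have -> : (p * (L1 (u_ k) - L1 u + L2 (h k)))%:E = (\int[mu]_x (e x)%:E)%E.
  rewrite /L1 -RintegralB// -RintegralD// -RintegralZl//.
  by rewrite fineK// integrable_fin_num.
have iu := vLp_integrable p0 Lu.
have iv := vLp_integrable p0 (Lv k).
have iuv := integrableD measurableT iu iv.
rewrite -integralD// -integralD//.
apply: le_integral => //; first exact: integrableD.
  exact: vLp_integrable.
move=> x _; rewrite /= -!EFinD lee_fin.
have := enorm_powRD_ge (u x) (v k x) hp.
rewrite {2}/v [u x + _]addrC subrK => pw; apply: le_trans pw.
rewrite /e /g /h (vdotC (u x) (_ *: _)) !vdotZl (vdotC (v k x)).
by rewrite -mulrBr -vdotBr mulrDl.
Qed.
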